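(* Let $\lambda\in\mathbb{N}_0^m$, $\alpha\in\mathbb{N}_0^l$, let $T:V(\lambda)\to V(\alpha)$ be a $\mathbb{C}$-linear operator, let $(C_1\times\cdots\times C_m,\;B_1\times\cdots\times B_m)$ be any Grace pair, and let $S_1,\dots,S_l\subseteq\mathbb{CP}^1$ be any sets. If $\operatorname{Symb}(T)$ is $(B_1\times\cdots\times B_m)\times(S_1\times\cdots\times S_l)$-stable, then $T$ maps $(C_1\times\cdots\times C_m)$-stable polynomials to nonzero $(S_1\times\cdots\times S_l)$-stable polynomials.
   Context: For $\lambda\in\mathbb{N}_0^m$, $V(\lambda)$ is the complex vector space of polynomials $p(x_1,y_1,\dots,x_m,y_m)$ with complex coefficients that are homogeneous of degree $\lambda_k$ in the pair $(x_k,y_k)$ for each $k$. Points of $\mathbb{CP}^1$ are written $(a:b)$ and identified with $\mathbb{C}\cup\{\infty\}$ via $a/b$. Zeros of $p\in V(\lambda)$ are considered in $(\mathbb{CP}^1)^m$. For $\Omega\subseteq(\mathbb{CP}^1)^m$, $p$ is $\Omega$-stable if it does not vanish in $\Omega$. Apolarity form: $D^\lambda:V(\lambda)\otimes V(\lambda)\to\mathbb{C}$, $D^\lambda:=\prod_{i=1}^m(\partial_{x_i}\otimes\partial_{y_i}-\partial_{y_i}\otimes\partial_{x_i})^{\lambda_i}$; explicitly $D^\lambda(p\otimes q)=\sum_{\mu\le\lambda}\binom{\lambda}{\mu}(-1)^{|\mu|}(\partial_x^{\lambda-\mu}\partial_y^{\mu}p)(\partial_x^{\mu}\partial_y^{\lambda-\mu}q)$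 (multi-index notation). Grace pair: for $S,S'\subseteq(\mathbb{CP}^1)^m$, $(S,S')$ is a Grace pair if for all $\lambda\in\mathbb{N}_0^m$ and all $p,q\in V(\lambda)$ with $p$ $S$-stable and $q$ $S'$-stable one has $D^\lambda(p\otimes q)\ne0$. Symbol: $\operatorname{Symb}(T):=T[(zy-xw)^\lambda]=\sum_{\mu\le\lambda}\binom{\lambda}{\mu}z^{\lambda-\mu}(-w)^\mu\,T(x^\mu y^{\lambda-\mu})\in V(\lambda\sqcup\alpha)$, where $\lambda\sqcup\alpha=(\lambda_1,\dots,\lambda_m,\alpha_1,\dots,\alpha_l)$, $T$ acts only on the $x,y$ variables, the pairs $(z_k,w_k)$, $k\le m$, are the first $m$ pairs of variables and the $l$ output pairs $(x_j,y_j)$ come last.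
   Formalization: The sets S_1,…,S_l are assumed nonempty; if some S_j is empty the claim fails, since T = 0 then has a vacuously stable symbol but maps every stable polynomial to zero. *)

(* Defs.v *)
From HB Require Import structures.
From mathcomp Require Import all_boot all_order all_algebra.
From mathcomp Require Import mpoly classical_sets.

Set Implicit Arguments.
Unset Strict Implicit.
Unset Printing Implicit Defensive.

Import GRing.Theory.
Local Open Scope ring_scope.

(* Multi-indices in N^n are the monomial exponents 'X_{1..n}; this is the
   concatenation (lambda_1, .., lambda_m, alpha_1, .., alpha_l). *)
Definition mcat m l (lam : 'X_{1..m}) (alp : 'X_{1..l}) : 'X_{1..m + l} :=
  [multinom match split i with inl k => lam k | inr j => alp j end | i < m + l].

Arguments mcat {m l} (lam alp)%_MM.

Lemma mcat_lshift m l (lam : 'X_{1..m}) (alp : 'X_{1..l}) (k : 'I_m) :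
  mcat lam alp (lshift l k) = lam k.
Proof. by rewrite mnmE -[lshift l k]/(unsplit (inl k)) unsplitK. Qed.

Lemma mcat_rshift m l (lam : 'X_{1..m}) (alp : 'X_{1..l}) (j : 'I_l) :
  mcat lam alp (rshift m j) = alp j.
Proof. by rewrite mnmE -[rshift m j]/(unsplit (inr j)) unsplitK. Qed.

(* Polynomials in n pairs of variables (x_k, y_k) live in {mpoly K[n + n]}:
   x_k is 'X_(lshift n k) and y_k is 'X_(rshift n k), so that
   'X_[mcat mu nu] is the monomial x^mu y^nu. *)
Section MultihomogeneousPolynomials.
Variables (K : fieldType) (n : nat).

Definition multihomog (lam : 'X_{1..n}) : {pred {mpoly K[n + n]}} :=
  fun p => all (fun mon : 'X_{1..n + n} =>
    [forall k, mon (lshift n k) + mon (rshift n k) == lam k]%N) (msupp p).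

Lemma multihomogP (lam : 'X_{1..n}) (p : {mpoly K[n + n]}) :
  reflect (forall mon, mon \in msupp p -> forall k,
             (mon (lshift n k) + mon (rshift n k))%N = lam k)
          (p \in multihomog lam).
Proof.
apply: (iffP allP) => hp mon /hp; first by move=> /forallP h k; apply/eqP.
by move=> h; apply/forallP => k; apply/eqP.
Qed.

Lemma multihomog_submod_closed lam : submod_closed (multihomog lam).
Proof.
split=> [|c p q /multihomogP hp /multihomogP hq]; apply/multihomogP => mon.
  by rewrite msupp0.
move/msuppD_le; rewrite mem_cat => /orP[/msuppZ_le /hp|/hq] //.
Qed.

HB.instance Definition _ lam :=
  GRing.isSubmodClosed.Build K {mpoly K[n + n]} (multihomog lam)
    (multihomog_submod_closed lam).

Record V (lam : 'X_{1..n}) := MkV {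
  poly_of_V :> {mpoly K[n + n]};
  _ : poly_of_V \in multihomog lam }.

HB.instance Definition _ lam := [isSub for @poly_of_V lam].
HB.instance Definition _ lam := [Choice of V lam by <:].
HB.instance Definition _ lam := [SubChoice_isSubLmodule of V lam by <:].

Lemma multihomogX (lam : 'X_{1..n}) (mon : 'X_{1..n + n}) :
  (forall k, (mon (lshift n k) + mon (rshift n k))%N = lam k) ->
  'X_[mon] \in multihomog lam.
Proof.
by move=> h; apply/multihomogP => m'; rewrite msuppX inE => /eqP ->.
Qed.

Lemma multihomogM (lam mu : 'X_{1..n}) (p q : {mpoly K[n + n]}) :
  p \in multihomog lam -> q \in multihomog mu ->
  p * q \in multihomog (lam + mu)%MM.
Proof.
move=> /multihomogP hp /multihomogP hq; apply/multihomogP => mon.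
case/msuppM_le/allpairsP=> -[m1 m2] /= [/hp h1 /hq h2 ->] k.
by rewrite !mnmDE -h1 -h2 addnACA.
Qed.

(* x^mu y^(lam - mu) as an element of V lam, for mu <= lam
   (and 0 for other mu). *)
Definition monomV (lam mu : 'X_{1..n}) : V lam :=
  insubd 0 'X_[mcat mu (lam - mu)].

Lemma val_monomV (lam mu : 'X_{1..n}) : (mu <= lam)%MM ->
  monomV lam mu = 'X_[mcat mu (lam - mu)] :> {mpoly K[n + n]}.
Proof.
move=> /mnm_lepP h; apply: insubdK; apply: multihomogX => k.
by rewrite mcat_lshift mcat_rshift mnmBE subnKC.
Qed.

End MultihomogeneousPolynomials.

Section ProjectiveLine.
Variable K : fieldType.

(* The projective line: lines through the origin in K^2. *)
Definition P1 := {L : {vspace (K^o * K^o)%type} | \dim L == 1%N}.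

(* zeta = (a : b) *)
Definition homog_coords (zeta : P1) (a b : K) : Prop :=
  ((a, b) : K^o * K^o) != 0 /\ ((a, b) : K^o * K^o) \in val zeta.

(* The valuation x_k := a_k, y_k := b_k. *)
Definition xy_val n (a b : 'I_n -> K) (i : 'I_(n + n)) : K :=
  match split i with inl k => a k | inr k => b k end.

(* By multihomogeneity, this does not depend on the choice of the
   homogeneous coordinates. *)
Definition vanishes_at n (lam : 'X_{1..n}) (p : V K lam)
    (zeta : 'I_n -> P1) : Prop :=
  exists a b : 'I_n -> K,
    (forall k, homog_coords (zeta k) (a k) (b k)) /\ p.@[xy_val a b] = 0.

Definition stable n (Omega : set ('I_n -> P1)) (lam : 'X_{1..n})
    (p : V K lam) : Prop :=
  forall zeta, Omega zeta -> ~ vanishes_at p zeta.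

Definition prod_set n (S : 'I_n -> set P1) : set ('I_n -> P1) :=
  [set zeta | forall k, S k (zeta k)]%classic.

(* The product of subsets of (P^1)^m and (P^1)^l in (P^1)^(m + l). *)
Definition cat_set m l (A : set ('I_m -> P1)) (B : set ('I_l -> P1)) :
    set ('I_(m + l) -> P1) :=
  [set zeta | A (fun k => zeta (lshift l k)) /\
              B (fun j => zeta (rshift m j))]%classic.

End ProjectiveLine.

Section Apolarity.
Variable K : fieldType.

Definition mbinom n (lam mu : 'X_{1..n}) : nat := \prod_(i < n) 'C(lam i, mu i).

(* Every summand is a constant polynomial, as p and q both have degree lam;
   D^lam (p (x) q) is the value of that constant. *)
Definition apolar n (lam : 'X_{1..n}) (p q : V K lam) : K :=
  (\sum_(mu : 'X_{1..n < (mdeg lam).+1} | (mu <= lam)%MM)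
     ((-1) ^+ mdeg mu *+ mbinom lam mu) *:
       ((p : {mpoly K[n + n]})^`M[mcat (lam - mu)%MM mu] *
        (q : {mpoly K[n + n]})^`M[mcat mu (lam - mu)%MM]))@_0%MM.

Definition Grace_pair m (S S' : set ('I_m -> P1 K)) : Prop :=
  forall (lam : 'X_{1..m}) (p q : V K lam),
    stable S p -> stable S' q -> apolar p q <> 0.

End Apolarity.

Section Symbol.
Variables (K : fieldType) (m l : nat).

(* The i-th variable of V(alpha), alpha in N^l, among the variables of
   V(mcat lambda alpha): the l pairs become the last l of the m + l pairs. *)
Definition last_var (i : 'I_(l + l)) : 'I_((m + l) + (m + l)) :=
  match split i with
  | inl j => lshift (m + l) (rshift m j)
  | inr j => rshift (m + l) (rshift m j)
  end.

Definition last_pairs (p : {mpoly K[l + l]}) :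
    {mpoly K[(m + l) + (m + l)]} :=
  p \mPo [tuple 'X_(last_var i) | i < l + l].

(* The pairs (z_k, w_k) are the first m of the m + l pairs. *)
Definition Symb_poly (lam : 'X_{1..m}) (alp : 'X_{1..l})
    (T : {linear V K lam -> V K alp}) : {mpoly K[(m + l) + (m + l)]} :=
  \sum_(mu : 'X_{1..m < (mdeg lam).+1} | (mu <= lam)%MM)
    ((-1) ^+ mdeg mu *+ mbinom lam mu) *:
      ('X_[mcat (mcat (lam - mu) 0) (mcat mu 0)] *
       last_pairs (T (monomV K lam mu))).

Lemma last_var_lshift j :
  last_var (lshift l j) = lshift (m + l) (rshift m j).
Proof. by rewrite /last_var -[lshift l j]/(unsplit (inl j)) unsplitK. Qed.

Lemma last_var_rshift j :
  last_var (rshift l j) = rshift (m + l) (rshift m j).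
Proof. by rewrite /last_var -[rshift l j]/(unsplit (inr j)) unsplitK. Qed.

Lemma last_var_inj : injective last_var.
Proof.
move=> i1 i2; rewrite -[i1]splitK -[i2]splitK.
case: (split i1) => j1; case: (split i2) => j2 /=;
  rewrite ?last_var_lshift ?last_var_rshift.
- by move=> /lshift_inj /rshift_inj ->.
- by move=> /eqP; rewrite eq_lrshift.
- by move=> /eqP; rewrite eq_rlshift.
- by move=> /rshift_inj /rshift_inj ->.
Qed.

Lemma last_pairs_multihomog (alp : 'X_{1..l}) (p : V K alp) :
  last_pairs p \in multihomog (mcat (0 : 'X_{1..m}) alp).
Proof.
case: p => p /= /multihomogP hp.
rewrite /last_pairs comp_mpolyEX big_seq; apply: rpred_sum => mon /hp h.
apply: rpredZ; rewrite comp_mpolyX.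
rewrite (eq_bigr (fun i => 'X_[(U_(last_var i) *+ mon i)%MM])); last first.
  by move=> i _; rewrite tnth_mktuple mpolyXn.
rewrite -(big_morph _ (@mpolyXD _ _) (@mpolyX0 _ _)); apply: multihomogX => k.
have image i : (\sum_i U_(last_var i) *+ mon i)%MM (last_var i) = mon i.
  rewrite mnm_sumE (bigD1 i) //= big1 => [|i' /negPf ne].
    by rewrite mulmnE mnm1E eqxx mul1n addn0.
  by rewrite mulmnE mnm1E (inj_eq last_var_inj) ne.
have noimage t : (forall i, last_var i != t) ->
    (\sum_i U_(last_var i) *+ mon i)%MM t = 0%N.
  move=> ne; rewrite mnm_sumE big1 // => i _.
  by rewrite mulmnE mnm1E (negPf (ne i)).
rewrite -[k]splitK; case: (split k) => j /=; last first.
  by rewrite mcat_rshift -last_var_lshift -last_var_rshift !image h.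
rewrite mcat_lshift mnm0E !noimage // => i.
  rewrite -[i]splitK; case: (split i) => j' /=.
    by rewrite last_var_lshift eq_lrshift.
  by rewrite last_var_rshift (inj_eq (@rshift_inj _ _)) eq_rlshift.
rewrite -[i]splitK; case: (split i) => j' /=.
  by rewrite last_var_lshift (inj_eq (@lshift_inj _ _)) eq_rlshift.
by rewrite last_var_rshift eq_rlshift.
Qed.

Lemma Symb_poly_multihomog (lam : 'X_{1..m}) (alp : 'X_{1..l})
    (T : {linear V K lam -> V K alp}) :
  Symb_poly T \in multihomog (mcat lam alp).
Proof.
apply: rpred_sum => mu /mnm_lepP le_mu_lam; apply: rpredZ.
have -> : mcat lam alp = (mcat lam 0 + mcat 0 alp)%MM.
  apply/mnmP => k; rewrite mnmDE -[k]splitK; case: (split k) => j /=.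
    by rewrite !mcat_lshift mnm0E addn0.
  by rewrite !mcat_rshift mnm0E add0n.
apply: multihomogM; last exact: last_pairs_multihomog.
apply: multihomogX => k; rewrite mcat_lshift mcat_rshift.
rewrite -[k]splitK; case: (split k) => j /=.
  by rewrite !mcat_lshift mnmBE subnK.
by rewrite !mcat_rshift mnm0E.
Qed.

Definition Symb (lam : 'X_{1..m}) (alp : 'X_{1..l})
    (T : {linear V K lam -> V K alp}) : V K (mcat lam alp) :=
  MkV (Symb_poly_multihomog T).

End Symbol.

(* Main.v *)
(** Fix homogeneous coordinates (a, b) of a point and put
    t_mu = T(x^mu y^(lam - mu))(a, b).  Freezing the output variables of
    Symb(T) at (a, b) gives the element q = sum_mu (-1)^|mu| binom(lam, mu) t_mu
    z^(lam - mu) w^mu of V(lam), whose apolar pairing with p is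
    (-1)^|lam| (lam!)^2 T(p)(a, b).  If the point lies in S_1 x .. x S_l, then q
    is stable on B_1 x .. x B_m, so the Grace pair property makes this pairing,
    hence T(p)(a, b), nonzero. *)

Require Import Defs.
From mathcomp Require Import all_boot all_order all_algebra.
From mathcomp Require Import mpoly complex boolp classical_sets reals ring.

Set Implicit Arguments.
Unset Strict Implicit.
Unset Printing Implicit Defensive.

Import GRing.Theory.
Local Open Scope ring_scope.
Local Open Scope complex_scope.

Lemma mcat_eq m l (a c : 'X_{1..m}) (b d : 'X_{1..l}) :
  (mcat a b == mcat c d) = (a == c) && (b == d).
Proof.
apply/eqP/andP => [/mnmP e|[/eqP-> /eqP->] //]; split; apply/eqP/mnmP => k.
  by have := e (lshift l k); rewrite !mcat_lshift.
by have := e (rshift m k); rewrite !mcat_rshift.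
Qed.

Lemma mnm_subK n (lam mu : 'X_{1..n}) :
  (mu <= lam)%MM -> (lam - (lam - mu))%MM = mu.
Proof. by move=> /mnm_lepP h; apply/mnmP => k; rewrite !mnmBE subKn. Qed.

Lemma prod_mcat_ffact n (a b : 'X_{1..n}) :
  (\prod_(i < n + n) mcat a b i ^_ mcat a b i =
   \prod_(k < n) ((a k)`! * (b k)`!))%N.
Proof.
rewrite big_split_ord big_split /=; congr (_ * _)%N; apply: eq_bigr => k _.
  by rewrite mcat_lshift ffactnn.
by rewrite mcat_rshift ffactnn.
Qed.

Lemma mbinom_fact n (lam mu : 'X_{1..n}) : (mu <= lam)%MM ->
  (mbinom lam mu * \prod_(k < n) ((mu k)`! * ((lam - mu)%MM k)`!) =
   \prod_(k < n) (lam k)`!)%N.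
Proof.
move=> /mnm_lepP h; rewrite /mbinom -big_split; apply: eq_bigr => k _ /=.
by rewrite mnmBE bin_fact.
Qed.

Lemma mbinom_sub n (lam mu : 'X_{1..n}) : (mu <= lam)%MM ->
  mbinom lam (lam - mu) = mbinom lam mu.
Proof.
by move=> /mnm_lepP h; apply: eq_bigr => k _; rewrite mnmBE bin_sub.
Qed.

Section ApolarityOfSymbol.
Variable K : fieldType.

Lemma poly_of_V_sum n (lam : 'X_{1..n}) (I : Type) (r : seq I) (P : pred I)
    (c : I -> K) (v : I -> V K lam) :
  (\sum_(i <- r | P i) c i *: v i : V K lam) =
  \sum_(i <- r | P i) c i *: (v i : {mpoly K[n + n]}) :> {mpoly K[n + n]}.
Proof. by rewrite (big_morph (@poly_of_V K n lam) (id1 := 0) (op1 := +%R)). Qed.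

(** Multihomogeneity recovers the x-exponents of a monomial from its y-exponents. Indexing by the
    latter makes this sum match that of [apolar] term by term. *)
Lemma V_monomE n (lam : 'X_{1..n}) (p : V K lam) :
  p = \sum_(mu : 'X_{1..n < (mdeg lam).+1} | (mu <= lam)%MM)
        p@_(mcat (lam - mu) mu) *: monomV K lam (lam - mu).
Proof.
apply: val_inj; apply/mpolyP => mon /=.
(* Where the indicator is 1 the two coefficients agree, so [p@_mon] can stand in every term; outside
   the support of [p] all terms are then 0. *)
rewrite poly_of_V_sum raddf_sum /= (eq_bigr (fun mu : 'X_{1..n < (mdeg lam).+1} =>
  p@_mon * (mcat (lam - mu) mu == mon)%:R)); last first.
  move=> mu le; rewrite mcoeffZ val_monomV ?lem_subr //.
  rewrite mnm_subK // mcoeffX.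
  by case: eqP => [->|] //; rewrite !mulr0.
have [hm|/memN_msupp_eq0 ->] := boolP (mon \in msupp p); last first.
  by rewrite big1 // => mu _; rewrite mul0r.
have /multihomogP /(_ _ hm) h := valP p.
pose nu := [multinom mon (rshift n k) | k < n].
have le_nu : (nu <= lam)%MM.
  by apply/mnm_lepP => k; rewrite mnmE -h leq_addl.
have E : mcat (lam - nu) nu = mon.
  apply/mnmP => i; rewrite -(splitK i); case: (split i) => k /=.
    by rewrite mcat_lshift mnmBE mnmE -h addnK.
  by rewrite mcat_rshift mnmE.
have lt_nu : (mdeg nu < (mdeg lam).+1)%N by rewrite ltnS lemc_mdeg // lem_leo.
rewrite (bigD1 (BMultinom lt_nu)) //= E eqxx mulr1 big1 ?addr0 // => mu.
case/andP => _ ne; rewrite -E mcat_eq (_ : (_ == nu) = false) ?andbF ?mulr0 //.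
by apply/negbTE; apply: contra ne => /eqP e; apply/eqP/val_inj.
Qed.

Definition alternating_poly n (lam : 'X_{1..n}) (t : 'X_{1..n} -> K) :
    {mpoly K[n + n]} :=
  \sum_(mu : 'X_{1..n < (mdeg lam).+1} | (mu <= lam)%MM)
    (((-1) ^+ mdeg mu *+ mbinom lam mu) * t mu) *: 'X_[mcat (lam - mu) mu].

Lemma alternating_poly_multihomog n (lam : 'X_{1..n}) t :
  alternating_poly lam t \in multihomog lam.
Proof.
apply: rpred_sum => mu /mnm_lepP le; apply: rpredZ; apply: multihomogX => k.
by rewrite mcat_lshift mcat_rshift mnmBE subnK.
Qed.

Definition alternatingV n (lam : 'X_{1..n}) (t : 'X_{1..n} -> K) : V K lam :=
  MkV (alternating_poly_multihomog lam t).

(** The monomial x^mu y^(lam - mu) comes from the summand of index lam - mu, hence the complementary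
    sign and argument of [t]; the binomial is symmetric. *)
Lemma mcoeff_alternating n (lam mu : 'X_{1..n}) t : (mu <= lam)%MM ->
  (alternating_poly lam t)@_(mcat mu (lam - mu)) =
    ((-1) ^+ mdeg (lam - mu) *+ mbinom lam mu) * t (lam - mu)%MM.
Proof.
move=> le; have lt : (mdeg (lam - mu) < (mdeg lam).+1)%N.
  by rewrite ltnS lemc_mdeg // lem_leo // lem_subr.
rewrite raddf_sum (bigD1 (BMultinom lt)) /= ?lem_subr //.
rewrite mcoeffZ mcoeffX mnm_subK // eqxx mulr1 mbinom_sub // big1 ?addr0 //.
move=> nu /andP[_ ne]; rewrite mcoeffZ mcoeffX mcat_eq.
rewrite [X in _ && X](_ : _ = false) ?andbF ?mulr0 //.
by apply/negbTE; apply: contra ne => /eqP e; apply/eqP/val_inj.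
Qed.

(** In each summand the derivatives pick out one coefficient of each polynomial, times mu! (lam -
    mu)!. The signs (-1)^|mu| and (-1)^|lam - mu| multiply to (-1)^|lam|; the two binomials, one
    from the form and one from [alternatingV], turn the two factorial products into (lam!)^2. *)
Lemma apolar_alternating n (lam : 'X_{1..n}) (t : 'X_{1..n} -> K)
    (p : V K lam) :
  apolar p (alternatingV lam t) =
    (-1) ^+ mdeg lam * (\prod_(k < n) (lam k)`!)%:R ^+ 2 *
    \sum_(mu : 'X_{1..n < (mdeg lam).+1} | (mu <= lam)%MM)
      p@_(mcat (lam - mu) mu) * t (lam - mu)%MM.
Proof.
rewrite /apolar raddf_sum mulr_sumr; apply: eq_bigr => mu le.
rewrite /= mcoeffZ rmorphM /= !mcoeff_mderivm !addm0 !prod_mcat_ffact.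
rewrite mcoeff_alternating // -(mbinom_fact le).
rewrite (_ : \prod_(k < n) (((lam - mu)%MM k)`! * (mu k)`!) =
   \prod_(k < n) ((mu k)`! * ((lam - mu)%MM k)`!))%N; last first.
  by apply: eq_bigr => k _; rewrite mulnC.
rewrite -[in (-1) ^+ mdeg lam](submK le) mdegD.
move: (mbinom _ _) (\prod_(_ < n) _)%N => c f.
by rewrite natrM exprD; ring.
Qed.

Lemma xy_val_lshift n (a b : 'I_n -> K) k : xy_val a b (lshift n k) = a k.
Proof. by rewrite /xy_val (unsplitK (inl _)). Qed.

Lemma xy_val_rshift n (a b : 'I_n -> K) k : xy_val a b (rshift n k) = b k.
Proof. by rewrite /xy_val (unsplitK (inr _)). Qed.

Lemma meval_Symb m l (lam : 'X_{1..m}) (alp : 'X_{1..l})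
    (T : {linear V K lam -> V K alp}) (a b : 'I_(m + l) -> K) :
  (Symb T).@[xy_val a b] =
  (alternatingV lam (fun mu => (T (monomV K lam mu)).@[
     xy_val (fun j => a (rshift m j)) (fun j => b (rshift m j))])).@[
     xy_val (fun k => a (lshift l k)) (fun k => b (lshift l k))].
Proof.
rewrite /= /Symb_poly /alternating_poly !raddf_sum; apply: eq_bigr => mu le /=.
(* The monomial in front involves only the first m pairs, the image under T only the last l, so the
   value factors. *)
rewrite !mevalZ rmorphM /= -mulrA; congr (_ * _); rewrite mulrC; congr (_ * _).
  rewrite comp_mpoly_meval; apply: meval_eq => i; rewrite tnth_mktuple mevalXU.
  rewrite -(splitK i); case: (split i) => j /=.
    by rewrite last_var_lshift !xy_val_lshift.
  by rewrite last_var_rshift !xy_val_rshift.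
rewrite !mevalX !big_split_ord /=; congr (_ * _).
  rewrite [X in _ * X]big1 ?mulr1 => [|j _]; last first.
    by rewrite mcat_lshift mcat_rshift mnm0E.
  by apply: eq_bigr => k _; rewrite !mcat_lshift !xy_val_lshift.
rewrite [X in _ * X]big1 ?mulr1 => [|j _]; last first.
  by rewrite !mcat_rshift mnm0E.
by apply: eq_bigr => k _; rewrite !mcat_rshift mcat_lshift !xy_val_rshift.
Qed.

(** A space of dimension 1 contains a nonzero vector. Since [vanishes_at] asks for coordinates, this
    is what makes the zero polynomial vanish at every point. *)
Lemma homog_coords_exist (zeta : P1 K) : exists a b : K, homog_coords zeta a b.
Proof.
exists (vpick (val zeta)).1, (vpick (val zeta)).2.
rewrite /homog_coords -surjective_pairing memv_pick vpick0 -dimv_eq0.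
by rewrite (eqP (valP zeta)).
Qed.

Lemma Grace_pair_Symb m l (lam : 'X_{1..m}) (alp : 'X_{1..l})
    (T : {linear V K lam -> V K alp}) (C B : set ('I_m -> P1 K))
    (Omega : set ('I_l -> P1 K)) (p : V K lam) :
  Grace_pair C B -> stable (cat_set B Omega) (Symb T) -> stable C p ->
  stable Omega (T p).
Proof.
move=> CB stT stp zeta Oz [a [b [hab Tp0]]].
pose t mu := (T (monomV K lam mu)).@[xy_val a b].
have stq : stable B (alternatingV lam t).
  move=> xi Bxi [c [d [hcd q0]]].
  (* A zero of q at [xi] is joined with [zeta] to give a zero of Symb(T); [glue] is generic in [X]
     to serve both points and coordinates. *)
  pose glue X (f : 'I_m -> X) (g : 'I_l -> X) (i : 'I_(m + l)) :=
    match split i with inl k => f k | inr j => g j end.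
  have glueL X (f : 'I_m -> X) g k : glue X f g (lshift l k) = f k.
    by rewrite /glue (unsplitK (inl _)).
  have glueR X (f : 'I_m -> X) g j : glue X f g (rshift m j) = g j.
    by rewrite /glue (unsplitK (inr _)).
  apply: (stT (glue _ xi zeta)).
    by split; rewrite /= (funext (glueL _ _ _), funext (glueR _ _ _)).
  exists (glue _ c a), (glue _ d b); split=> [k|].
    by rewrite -(splitK k); case: (split k) => j; rewrite /= ?glueL ?glueR.
  rewrite meval_Symb -[RHS]q0.
  by rewrite /t !(funext (glueL _ _ _)) !(funext (glueR _ _ _)).
apply: (CB _ _ _ stp stq).
(* By linearity of T and the expansion of [p], the remaining sum is T(p)(a, b), which is 0. *)
rewrite apolar_alternating [X in _ * X](_ : _ = 0) ?mulr0 // -[RHS]Tp0.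
rewrite [in RHS](V_monomE p) linear_sum /= (eq_bigr _ (fun _ _ => linearZ _ _)).
rewrite poly_of_V_sum raddf_sum; apply: eq_bigr => mu _ /=.
by rewrite mevalZ.
Qed.

End ApolarityOfSymbol.

(* [S_ne] excludes the degenerate case of an empty S_j: every polynomial is
   then stable for the empty product, so that T = 0 would satisfy [Symb_st]. *)
Theorem proposition6p5 (R : realType) (m l : nat)
  (lam : 'X_{1..m}) (alp : 'X_{1..l})
  (T : {linear V R[i] lam -> V R[i] alp})
  (C B : 'I_m -> set (P1 R[i]))
  (CB : Grace_pair (prod_set C) (prod_set B))
  (S : 'I_l -> set (P1 R[i]))
  (S_ne : forall j, exists zeta, S j zeta)
  (Symb_st : stable (cat_set (prod_set B) (prod_set S)) (Symb T)) :
  forall p : V R[i] lam, stable (prod_set C) p ->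
    T p <> 0 /\ stable (prod_set S) (T p).
Proof.
move=> p stp; have stTp := Grace_pair_Symb CB Symb_st stp.
(* The zero polynomial would vanish at a point of the nonempty product of the S_j, against
   stability. *)
split=> // Tp0; have [zeta Szeta] := fin_all_exists S_ne.
have [a /fin_all_exists[b hab]] :=
  fin_all_exists (fun j => homog_coords_exist (zeta j)).
by apply: (stTp zeta Szeta); exists a, b; rewrite Tp0 meval0.
Qed.
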